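(* Let $\mu>0$ and consider the multinomial logit model with utilities $V_{ni}(\boldsymbol{\beta})=\boldsymbol{\beta}^\top\mathbf{x}_{ni}$, $n=1,\dots,N$, $i=1,\dots,K$, $\boldsymbol{\beta}\in\mathbb{R}^d$, and choice probabilities $$\hat p_{ni}(\boldsymbol{\beta})=\frac{\exp\big(V_{ni}(\boldsymbol{\beta})/\mu\big)}{\sum_{j}\exp\big(V_{nj}(\boldsymbol{\beta})/\mu\big)}.$$ For an observation $(\mathbf{X}_n,y_n)$, with $\mathbf{X}_n=(\mathbf{x}_{n1},\dots,\mathbf{x}_{nK})$ and chosen alternative $y_n\in\{1,\dots,K\}$, the Fenchel--Young loss associated with the scaled Shannon entropy $\Lambda(\mathbf{q})=\mu\sum_i q_i\log q_i$ is $$\ell_{\mathrm{FY}}(\boldsymbol{\beta};\mathbf{X}_n,y_n)=\mu\log\sum_{j}\exp\big(\boldsymbol{\beta}^\top\mathbf{x}_{nj}/\mu\big)-\boldsymbol{\beta}^\top\mathbf{x}_{n y_n},$$ and it coincides with $\mu$ times the negative log-likelihood: $$\ell_{\mathrm{FY}}(\boldsymbol{\beta};\mathbf{X}_n,y_n)=\mu\cdot\big(-\log\hat p_{n y_n}(\boldsymbol{\beta})\big).$$ Consequently the Fenchel--Young estimator and the maximum likelihood estimator of this model are identical, $\hat{\boldsymbol{\beta}}_{\mathrm{FY}}=\hat{\boldsymbol{\beta}}_{\mathrm{MLE}}$.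
   Context: $\Delta\subset\mathbb{R}^K$ is the probability simplex. For a perturbation function $\Lambda$ on $\Delta$, the surplus function is $\Omega(\mathbf{V})=\sup_{\mathbf{q}\in\Delta}\{\mathbf{q}^\top\mathbf{V}-\Lambda(\mathbf{q})\}$. The Fenchel--Young loss of an observation with utility vector $\mathbf{V}_n(\boldsymbol{\beta})=(V_{n1}(\boldsymbol{\beta}),\dots,V_{nK}(\boldsymbol{\beta}))$ and chosen alternative $y_n$ is $\ell_{\mathrm{FY}}(\boldsymbol{\beta};\mathbf{X}_n,y_n)=\Omega(\mathbf{V}_n(\boldsymbol{\beta}))-V_{n y_n}(\boldsymbol{\beta})$. The Fenchel--Young estimator $\hat{\boldsymbol{\beta}}_{\mathrm{FY}}$ is a minimizer of $\frac1N\sum_{n=1}^N\ell_{\mathrm{FY}}(\boldsymbol{\beta};\mathbf{X}_n,y_n)$ over $\boldsymbol{\beta}$; the maximum likelihood estimator $\hat{\boldsymbol{\beta}}_{\mathrm{MLE}}$ is a minimizer of $-\sum_{n=1}^N\log\hat p_{n y_n}(\boldsymbol{\beta})$. Equality of estimators means that the sets of minimizers coincide. Convention: $0\log 0=0$. *)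

(* Defs.v *)
From HB Require Import structures.
From mathcomp Require Import all_boot all_order all_algebra.
From mathcomp Require Import all_classical all_reals all_analysis.

Set Implicit Arguments.
Unset Strict Implicit.
Unset Printing Implicit Defensive.

Import Order.TTheory GRing.Theory Num.Theory.

Local Open Scope classical_set_scope.
Local Open Scope ring_scope.

Definition simplex (R : realType) (K : nat) : set 'cV[R]_K :=
  [set q | (forall i, 0 <= q i 0) /\ \sum_i q i 0 = 1].

(* The supremum is taken in the extended reals, so that it is meaningful
   without any boundedness assumption on the perturbation function; only the
   values of [Lambda] on the simplex matter. *)
Definition surplus (R : realType) (K : nat) (Lambda : 'cV[R]_K -> R)
    (V : 'cV[R]_K) : \bar R :=
  ereal_sup [set ((q^T *m V) 0 0 - Lambda q)%:E | q in @simplex R K].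

Definition fy_loss (R : realType) (K : nat) (Lambda : 'cV[R]_K -> R)
    (V : 'cV[R]_K) (y : 'I_K) : \bar R :=
  (surplus Lambda V - (V y 0)%:E)%E.

Definition minimizers (T : Type) (disp : Order.disp_t) (S : porderType disp)
    (f : T -> S) : set T :=
  [set b | forall b', (f b <= f b')%O].

Definition fy_estimators (R : realType) (N K d : nat) (Lambda : 'cV[R]_K -> R)
    (V : 'I_N -> 'cV[R]_d -> 'cV[R]_K) (y : 'I_N -> 'I_K) : set 'cV[R]_d :=
  minimizers (fun beta : 'cV[R]_d =>
    ((N%:R^-1)%:E * \sum_(n < N) fy_loss Lambda (V n beta) (y n))%E).

(* The convention 0 log 0 = 0 is automatic: [ln] is total and its (junk) value
   at 0 is multiplied by 0. *)
Definition scaled_shannon (R : realType) (K : nat) (mu : R) (q : 'cV[R]_K) : R :=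
  mu * \sum_i q i 0 * ln (q i 0).

Definition linear_utility (R : realType) (K d : nat) (X : 'I_K -> 'cV[R]_d)
    (beta : 'cV[R]_d) : 'cV[R]_K :=
  \col_i (beta^T *m X i) 0 0.

Definition logit_prob (R : realType) (K : nat) (mu : R) (V : 'cV[R]_K)
    (i : 'I_K) : R :=
  expR (V i 0 / mu) / \sum_j expR (V j 0 / mu).

Definition logit_mle (R : realType) (N K d : nat) (mu : R)
    (V : 'I_N -> 'cV[R]_d -> 'cV[R]_K) (y : 'I_N -> 'I_K) : set 'cV[R]_d :=
  minimizers (fun beta : 'cV[R]_d =>
    - \sum_(n < N) ln (logit_prob mu (V n beta) (y n))).

(* Main.v *)
Require Import Defs.
From HB Require Import structures.
From mathcomp Require Import all_boot all_order all_algebra.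
From mathcomp Require Import all_classical all_reals all_analysis.
From mathcomp Require Import ring.

(** The heart of the matter is the Gibbs variational principle: the convex
    conjugate of the scaled entropy [mu * \sum_i q_i ln q_i] on the simplex is
    the log-sum-exp function [mu * L], where [L = ln \sum_j expR (V_j / mu)].
    Indeed, with [p_i = expR (V_i / mu - L)] the logit probabilities,

      q^T V - mu \sum_i q_i ln q_i - mu L = mu \sum_i q_i (ln p_i - ln q_i),

    which is [- mu] times the relative entropy of [q] with respect to [p].  It
    is nonpositive by [mul_sub_ln_le], the tangent inequality [1 + t <= e^t]
    applied coordinatewise, the bounds [p_i - q_i] summing to zero; and it
    vanishes at [q = p].  Hence [surplus_scaled_shannon].

    Subtracting the utility of the chosen alternative leaves [- mu ln p_y], so
    the average Fenchel-Young loss is the negative log-likelihood multiplied by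
    [mu / N > 0], and a positive factor preserves the minimizers. *)

Set Implicit Arguments.
Unset Strict Implicit.
Unset Printing Implicit Defensive.

Import Order.TTheory GRing.Theory Num.Theory.

Local Open Scope classical_set_scope.
Local Open Scope ring_scope.

(** Tangent inequality [1 + t <= expR t] at [t = a - ln q], multiplied by [q].
    Parametrising by the logarithm [a] of the reference weight keeps that
    weight positive, so that only [q = 0] is exceptional. *)
Lemma mul_sub_ln_le (R : realType) (a q : R) :
  0 <= q -> q * (a - ln q) <= expR a - q.
Proof.
rewrite le_eqVlt => /predU1P[<-|q_gt0]; first by rewrite mul0r subr0 expR_ge0.
have := expR_ge1Dx (a - ln q).
rewrite expRD expRN lnK ?posrE// ler_pdivlMr// => h.
by rewrite lerBrDl -{1}[q]mulr1 -mulrDr mulrC.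
Qed.

Lemma sum_expR_gt0 (R : realType) (K : nat) (v : 'I_K -> R) :
  (0 < K)%N -> 0 < \sum_j expR (v j).
Proof.
case: K v => // K v _; rewrite big_ord_recl ltr_pwDl ?expR_gt0//.
by apply: sumr_ge0 => j _; exact: expR_ge0.
Qed.

(** Log-sum-exp is the shift that turns the [v i] into log-probabilities; this
    makes the logit vector a point of the simplex. *)
Lemma sum_expR_sub_ln_sum (R : realType) (K : nat) (v : 'I_K -> R) :
  (0 < K)%N -> \sum_i expR (v i - ln (\sum_j expR (v j))) = 1.
Proof.
move=> /(sum_expR_gt0 v) S_gt0.
under eq_bigr do rewrite expRD expRN lnK ?posrE//.
by rewrite -mulr_suml divff// gt_eqF.
Qed.

(** Any constant [L] may be pulled out of the sum because [\sum_i q_i = 1].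
    When [L] normalises the weights [expR (V_i / mu - L)], the remaining sum is
    minus the relative entropy of [q] with respect to them. *)
Lemma scaled_shannon_gap (R : realType) (K : nat) (mu : R) (V q : 'cV[R]_K)
    (L : R) : mu != 0 -> simplex q ->
  (q^T *m V) 0 0 - scaled_shannon mu q =
    mu * L + mu * \sum_i q i 0 * (V i 0 / mu - L - ln (q i 0)).
Proof.
move=> mu_neq0 [_ q1]; rewrite /scaled_shannon mxE.
rewrite -[X in mu * X + _]mulr1 -q1 !mulr_sumr -sumrB -big_split /=.
by apply: eq_bigr => i _; rewrite mxE; field.
Qed.

(** Gibbs variational principle; the supremum is attained at the logit
    probabilities. *)
Lemma surplus_scaled_shannon (R : realType) (K : nat) (mu : R)
    (V : 'cV[R]_K) : (0 < K)%N -> 0 < mu ->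
  surplus (scaled_shannon mu) V = (mu * ln (\sum_j expR (V j 0 / mu)))%:E.
Proof.
move=> K_gt0 mu_gt0; have mu_neq0 : mu != 0 by rewrite gt_eqF.
set L := ln _; have p1 : \sum_i expR (V i 0 / mu - L) = 1.
  exact: (sum_expR_sub_ln_sum (fun i => V i 0 / mu)).
apply/eqP; rewrite eq_le; apply/andP; split.
  apply: ge_ereal_sup => _ [q qP <-].
  rewrite lee_fin (scaled_shannon_gap V L)// gerDl pmulr_rle0//.
  have [q_ge0 q1] := qP.
  apply: (@le_trans _ _ (\sum_i (expR (V i 0 / mu - L) - q i 0))).
    by apply: ler_sum => i _; exact: mul_sub_ln_le.
  by rewrite sumrB p1 q1 subrr.
have pP : simplex (\col_i expR (V i 0 / mu - L)).
  split=> [i|]; first by rewrite mxE expR_ge0.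
  by under eq_bigr do rewrite mxE.
apply: ereal_sup_ubound; exists (\col_i expR (V i 0 / mu - L)) => //.
rewrite (scaled_shannon_gap V L)//.
rewrite [X in _ + mu * X]big1 ?mulr0 ?addr0// => i _.
by rewrite mxE expRK subrr mulr0.
Qed.

Lemma ln_logit_prob (R : realType) (K : nat) (mu : R) (V : 'cV[R]_K)
    (i : 'I_K) :
  ln (logit_prob mu V i) = V i 0 / mu - ln (\sum_j expR (V j 0 / mu)).
Proof.
have K_gt0 : (0 < K)%N by case: K V i => [? []|].
by rewrite /logit_prob ln_div ?posrE ?expR_gt0 ?sum_expR_gt0// expRK.
Qed.

Lemma fy_loss_scaled_shannon (R : realType) (K : nat) (mu : R)
    (V : 'cV[R]_K) (i : 'I_K) : 0 < mu ->
  fy_loss (scaled_shannon mu) V i =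
    (mu * ln (\sum_j expR (V j 0 / mu)) - V i 0)%:E.
Proof.
move=> mu_gt0; have K_gt0 : (0 < K)%N by case: K V i => [? []|].
by rewrite /fy_loss surplus_scaled_shannon.
Qed.

Lemma fy_loss_logit (R : realType) (K : nat) (mu : R) (V : 'cV[R]_K)
    (i : 'I_K) : 0 < mu ->
  fy_loss (scaled_shannon mu) V i = (mu * - ln (logit_prob mu V i))%:E.
Proof.
move=> mu_gt0; rewrite fy_loss_scaled_shannon// ln_logit_prob.
by congr EFin; field; rewrite gt_eqF.
Qed.

Lemma minimizers_pscale (R : realType) (T : Type) (c : R) (f : T -> R) :
  0 < c -> minimizers (fun b => (c * f b)%:E) = minimizers f.
Proof.
by move=> c_gt0; apply/seteqP; split=> b bP b';
  have := bP b'; rewrite lee_fin ler_pM2l.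
Qed.

Theorem proposition3 (R : realType) (N K d : nat) (N_gt0 : (0 < N)%N)
    (mu : R) (mu_gt0 : 0 < mu)
    (x : 'I_N -> 'I_K -> 'cV[R]_d) (y : 'I_N -> 'I_K) :
  (forall (n : 'I_N) (beta : 'cV[R]_d),
     fy_loss (scaled_shannon mu) (linear_utility (x n) beta) (y n) =
       (mu * ln (\sum_j expR ((beta^T *m x n j) 0 0 / mu))
          - (beta^T *m x n (y n)) 0 0)%:E
     /\
     fy_loss (scaled_shannon mu) (linear_utility (x n) beta) (y n) =
       (mu * - ln (logit_prob mu (linear_utility (x n) beta) (y n)))%:E)
  /\
  fy_estimators (scaled_shannon mu) (fun n => linear_utility (x n)) y =
    logit_mle mu (fun n => linear_utility (x n)) y.
Proof.
split=> [n beta|].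
  split; last exact: fy_loss_logit.
  rewrite fy_loss_scaled_shannon// mxE.
  by under eq_bigr do rewrite mxE.
have c_gt0 : 0 < N%:R^-1 * mu by rewrite mulr_gt0// invr_gt0 ltr0n.
rewrite /logit_mle -(minimizers_pscale _ c_gt0) /fy_estimators.
congr (minimizers _); apply/funext => beta.
under eq_bigr do rewrite fy_loss_logit//.
by rewrite sumEFin -EFinM -mulr_sumr sumrN mulrA.
Qed.
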